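(* Let $P\subset\mathbb{R}^n$ be a Delone set of finite local complexity. There exists $\epsilon$ with $0<\epsilon<1$ such that for all differentiable functions $\varphi:\mathbb{R}^n\to\mathbb{R}^n$ whose differential is strongly $P$-equivariant and satisfies $\|d(\varphi-\mathrm{id})\|_\infty<\epsilon$ the following holds: for all $r>0$ there exists $r'>0$ such that for all $x,y\in\mathbb{R}^n$, $$B_{r'}[\varphi(P)-\varphi(x)]=B_{r'}[\varphi(P)-\varphi(y)]\ \Longrightarrow\ B_r[P-x]=B_r[P-y].$$
   Context: $B(x,r)$ is the open ball in $\mathbb{R}^n$ and, for $P\subset\mathbb{R}^n$, $B_r[P]=B(0,r)\cap P$. $P$ is uniformly discrete if $\inf\{|x-y| : x\neq y\in P\}>0$, relatively dense if there is $r$ such that $B_r[P-x]\ne\emptyset$ for all $x\in\mathbb{R}^n$, and Delone if both. $P$ has finite local complexity if for every $r$ there are only finitely many distinct sets $B_r[P-x]$, $x\in P$. A function $f$ on $\mathbb{R}^n$ is strongly $P$-equivariant if there is a finite $R$ such that for all $x,y\in\mathbb{R}^n$, $B_R[P-x]=B_R[P-y]$ implies $f(x)=f(y)$. Differentials are viewed as functions on $\mathbb{R}^n$ with values in linear maps, and $\|d\eta\|_\infty$ is the supremum over $\mathbb{R}^n$ of the operator norm of $d\eta$. *)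

(* Defs.v *)
From mathcomp Require Import all_boot all_order all_algebra.
From mathcomp Require Import all_classical all_reals all_analysis.

Set Implicit Arguments.
Unset Strict Implicit.
Unset Printing Implicit Defensive.

Import Order.TTheory GRing.Theory Num.Theory.
Import numFieldNormedType.Exports.

Local Open Scope classical_set_scope.
Local Open Scope ring_scope.

(* The library norm `|v| on 'rV[R]_n is the sup norm; it is only used (through
   the topology it induces) for differentiability.  All metric notions below
   refer to the Euclidean norm. *)
Definition enorm (R : realType) (n : nat) (v : 'rV[R]_n) : R :=
  Num.sqrt (\sum_(i < n) v 0 i ^+ 2).

Definition eball (R : realType) (n : nat) (x : 'rV[R]_n) (r : R) :
    set 'rV[R]_n :=
  [set y | enorm (y - x) < r].

(* P - x *)
Definition translate (R : realType) (n : nat) (P : set 'rV[R]_n)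
    (x : 'rV[R]_n) : set 'rV[R]_n :=
  [set p - x | p in P].

(* B_r[P] *)
Definition local_patch (R : realType) (n : nat) (r : R) (P : set 'rV[R]_n) :
    set 'rV[R]_n :=
  eball 0 r `&` P.

(* The infimum is taken in the extended reals, so it is +oo when P has at most
   one point. *)
Definition uniformly_discrete (R : realType) (n : nat)
    (P : set 'rV[R]_n) : Prop :=
  (0 < ereal_inf [set d : \bar R |
         exists x y, [/\ P x, P y, x != y & d = (enorm (x - y))%:E]])%E.

Definition relatively_dense (R : realType) (n : nat)
    (P : set 'rV[R]_n) : Prop :=
  exists r : R, forall x : 'rV[R]_n, local_patch r (translate P x) !=set0.

Definition delone (R : realType) (n : nat) (P : set 'rV[R]_n) : Prop :=
  uniformly_discrete P /\ relatively_dense P.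

Definition finite_local_complexity (R : realType) (n : nat)
    (P : set 'rV[R]_n) : Prop :=
  forall r : R, finite_set [set local_patch r (translate P x) | x in P].

Definition strongly_equivariant (R : realType) (n : nat) (T : Type)
    (P : set 'rV[R]_n) (f : 'rV[R]_n -> T) : Prop :=
  exists rho : R, forall x y : 'rV[R]_n,
    local_patch rho (translate P x) = local_patch rho (translate P y) -> f x = f y.

Definition opnorm (R : realType) (n : nat)
    (L : 'rV[R]_n -> 'rV[R]_n) : \bar R :=
  ereal_sup [set (enorm (L v))%:E | v in [set v | enorm v <= 1]].

(* || d eta ||_oo, possibly +oo *)
Definition diff_supnorm (R : realType) (n : nat)
    (eta : 'rV[R]_n -> 'rV[R]_n) : \bar R :=
  ereal_sup (range (fun x => opnorm ('d eta x))).

(* Main.v *)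
Require Import Defs.
From mathcomp Require Import all_boot all_order all_algebra.
From mathcomp Require Import all_classical all_reals all_analysis.
From mathcomp Require Import ring lra.

Set Implicit Arguments.
Unset Strict Implicit.
Unset Printing Implicit Defensive.

Import Order.TTheory GRing.Theory Num.Theory.
Import numFieldNormedType.Exports.

(** Write e for the bound on the derivative of phi - id. By the mean value
    inequality phi - id is e-Lipschitz, so for e <= 1/2 the map phi is injective
    and distorts distances by bounded factors, and a difference phi p - phi q of
    image points determines p - q up to an error proportional to e |p - q|.

    Rigidity of P absorbs this error. Finite local complexity leaves finitely
    many vectors p - q of bounded length with p, q in P, hence a positive
    separation between them [differences_separated]. If e is small against that
    separation, equal differences phi p - phi q = phi p' - phi q' of
    neighbouring points force p - q = p' - q' [eq_neighbor_difference].

    Suppose now that phi(P) looks the same around phi x and around phi y, up to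
    a large radius. Pick p0 in P near x and the point p0' of P whose image sits
    relative to phi y as phi p0 does relative to phi x. Relative density joins
    p0 to any other point of P by short steps [relatively_dense_ind]; along such
    a chain rigidity propagates, so translation by t = p0' - p0 carries P near
    p0 into P [transfer_points]. The situation is symmetric in x and y, hence
    P near p0 and P near p0' are translates of each other
    [local_patch_shift].

    It remains to see that y = x + t. The derivative of phi is a function of
    the local pattern of P, so it takes the same value at z and at z + t for z
    on the segment from p0 to x, and phi has equal increments along this segment
    and along its translate [eq_diff_translate]. Thus
    phi (x + t) - phi p0' = phi x - phi p0 = phi y - phi p0', and injectivity of
    phi concludes. *)

Local Open Scope classical_set_scope.
Local Open Scope ring_scope.

(** * Euclidean norm *)

Definition dotv (R : realType) (n : nat) (u v : 'rV[R]_n) : R :=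
  \sum_(i < n) u 0 i * v 0 i.

Section Euclidean.
Variables (R : realType) (n : nat).
Implicit Types (u v w : 'rV[R]_n) (k M : R).

Lemma enorm_ge0 v : 0 <= enorm v.
Proof. exact: sqrtr_ge0. Qed.

Lemma sqr_enorm v : enorm v ^+ 2 = dotv v v.
Proof.
rewrite sqr_sqrtr; last by apply: sumr_ge0 => i _; exact: sqr_ge0.
by apply: eq_bigr => i _; rewrite expr2.
Qed.

Lemma coord_le_enorm v i : `|v 0 i| <= enorm v.
Proof.
rewrite -[leLHS]sqrtr_sqr ler_sqrt; last first.
  by apply: sumr_ge0 => j _; exact: sqr_ge0.
by rewrite (bigD1 i) //= lerDl; apply: sumr_ge0 => j _; exact: sqr_ge0.
Qed.

Lemma enorm_le_coord v M : 0 <= M -> (forall i, `|v 0 i| <= M) ->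
  enorm v <= n%:R * M.
Proof.
move=> M0 vM.
rewrite -(@ler_pXn2r _ 2) ?nnegrE ?enorm_ge0 ?mulr_ge0// sqr_enorm.
have : dotv v v <= \sum_(i < n) M ^+ 2.
  apply: ler_sum => i _.
  by rewrite -expr2 -real_normK ?num_real// ler_pXn2r ?nnegrE.
move=> /le_trans; apply.
rewrite sumr_const card_ord -[leLHS]mulr_natl exprMn ler_wpM2r ?sqr_ge0//.
by rewrite -natrX ler_nat -{1}[n]muln1 expnS leq_mul2l expn1; case: (n).
Qed.

Lemma enorm0_eq0 v : enorm v = 0 -> v = 0.
Proof.
move=> v0; apply/rowP => i; rewrite mxE; apply/eqP.
by rewrite -normr_le0 -v0 coord_le_enorm.
Qed.

Lemma enormZ k v : enorm (k *: v) = `|k| * enorm v.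
Proof.
rewrite /enorm -sqrtr_sqr -sqrtrM ?sqr_ge0// mulr_sumr; congr Num.sqrt.
by apply: eq_bigr => i _; rewrite mxE exprMn.
Qed.

Lemma enorm0 : enorm (0 : 'rV[R]_n) = 0.
Proof. by rewrite -(scale0r 0) enormZ normr0 mul0r. Qed.

Lemma enormN v : enorm (- v) = enorm v.
Proof. by rewrite -scaleN1r enormZ normrN1 mul1r. Qed.

Lemma enorm_distC u v : enorm (u - v) = enorm (v - u).
Proof. by rewrite -enormN opprB. Qed.

Lemma dotv0 u : dotv u 0 = 0.
Proof. by rewrite /dotv big1// => i _; rewrite mxE mulr0. Qed.

(** Cauchy-Schwarz: after multiplication by 2ab, where a = |u| and b = |v|, the
    difference of the two sides is the sum of the squares (b u_i - a v_i)^2. *)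
Lemma dotv_le_enorm u v : dotv u v <= enorm u * enorm v.
Proof.
have [/enorm0_eq0 ->|u0] := eqVneq (enorm u) 0.
  by rewrite enorm0 mul0r /dotv big1// => i _; rewrite mxE mul0r.
have [/enorm0_eq0 ->|v0] := eqVneq (enorm v) 0.
  by rewrite enorm0 mulr0 dotv0.
set a := enorm u in u0 *; set b := enorm v in v0 *.
have a0 : 0 < a by rewrite lt0r u0 enorm_ge0.
have b0 : 0 < b by rewrite lt0r v0 enorm_ge0.
have ab0 : 0 < 2 * (a * b) by rewrite !mulr_gt0.
rewrite -(ler_pM2l ab0).
have -> : 2 * (a * b) * (a * b) = b ^+ 2 * dotv u u + a ^+ 2 * dotv v v.
  by rewrite -!sqr_enorm -/a -/b; ring.
rewrite /dotv !mulr_sumr -big_split /=; apply: ler_sum => i _.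
by have := sqr_ge0 (b * u 0 i - a * v 0 i); lra.
Qed.

Lemma dotvDl u v w : dotv (u + v) w = dotv u w + dotv v w.
Proof. by rewrite -big_split /=; apply: eq_bigr => i _; rewrite mxE mulrDl. Qed.

Lemma dotvBr u v w : dotv u (v - w) = dotv u v - dotv u w.
Proof. by rewrite -sumrB; apply: eq_bigr => i _; rewrite !mxE mulrBr. Qed.

Lemma ler_enormD u v : enorm (u + v) <= enorm u + enorm v.
Proof.
have [|uv0] := lerP (enorm (u + v)) 0.
  by move=> /le_trans; apply; rewrite addr_ge0 ?enorm_ge0.
rewrite -(ler_pM2r uv0) mulrDl -expr2 sqr_enorm dotvDl.
by rewrite lerD ?dotv_le_enorm.
Qed.

Lemma ler_enorm_dist v u w : enorm (u - w) <= enorm (u - v) + enorm (v - w).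
Proof. by rewrite (le_trans _ (ler_enormD _ _))// addrA subrK. Qed.

End Euclidean.

(** * Mean value theorem and Lipschitz bounds *)

Section MeanValue.
Variables (R : realType) (n : nat).
Implicit Types (f : 'rV[R]_n -> 'rV[R]_n) (u v w : 'rV[R]_n).

Lemma is_derive_dotv_line f u v w (s : R) :
  (forall z, differentiable f z) ->
  is_derive s 1 (fun s => dotv w (f (v + s *: u)))
    (dotv w ('d f (v + s *: u) u)).
Proof.
move=> df.
have lineP : is_diff s (fun s : R => v + s *: u) (fun h => h *: u).
  have := is_diffD (is_diff_cst v s) (is_diff_scalel s u).
  by rewrite add0r.
pose g := f \o (fun s : R => v + s *: u).
have dg : differentiable g s by apply: differentiable_comp.
have Dg : 'D_1 g s = 'd f (v + s *: u) u.
  by rewrite deriveE// diff_comp//= diff_val scale1r.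
have gP : derivable g s 1 by exact: diff_derivable.
have giP i : is_derive s 1 (fun s => g s 0 i) ('d f (v + s *: u) u 0 i).
  rewrite -Dg derive_mx// mxE; apply: derivableP.
  by have /derivable_mxP := gP; apply.
rewrite (_ : (fun s => _) = \sum_(i < n) w 0 i \*: (fun s => g s 0 i)).
  exact: is_derive_sum.
by apply/funext => t; rewrite fct_sumE.
Qed.

(** A vector-valued function has no mean value theorem of its own; testing it
    against a fixed vector w reduces the matter to a real function of one
    variable, at the price of a point c that depends on w. *)
Lemma mean_value_dotv f u v w : (forall z, differentiable f z) ->
  exists2 c, 0 <= c <= 1 &
    dotv w (f u - f v) = dotv w ('d f (v + c *: (u - v)) (u - v)).
Proof.
move=> df.
pose g (s : R) := dotv w (f (v + s *: (u - v))).
have gP s := is_derive_dotv_line (u - v) v w s df.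
have g1 : g 1 = dotv w (f u) by rewrite /g scale1r addrC subrK.
have g0 : g 0 = dotv w (f v) by rewrite /g scale0r addr0.
have [c c01] : exists2 c, c \in `[0, 1]%R &
    g 1 - g 0 = dotv w ('d f (v + c *: (u - v)) (u - v)) * (1 - 0).
  apply: (@MVT_segment _ g
    (fun s => dotv w ('d f (v + s *: (u - v)) (u - v)))) => //.
  apply: continuous_subspaceT => s; apply: differentiable_continuous.
  by apply/derivable1_diffP; have [] := gP s.
rewrite g1 g0 -dotvBr subr0 mulr1 => ->.
by exists c.
Qed.

Lemma le_enorm_opnorm f x v e : (diff_supnorm f < e%:E)%E ->
  enorm ('d f x v) <= e * enorm v.
Proof.
move=> fe.
have [->|v0] := eqVneq v 0; first by rewrite linear0 enorm0 mulr0.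
have nv0 : 0 < enorm v.
  by rewrite lt0r enorm_ge0 andbT; apply: contra_neq v0 => /enorm0_eq0.
pose v1 := (enorm v)^-1 *: v.
have v11 : enorm v1 <= 1.
  by rewrite enormZ ger0_norm ?invr_ge0 ?enorm_ge0// mulVf ?gt_eqF.
have : ((enorm ('d f x v1))%:E <= e%:E)%E.
  apply: le_trans (ltW fe); apply: (@le_trans _ _ (opnorm ('d f x))).
    by apply: ereal_sup_ubound; exists v1.
  by apply: ereal_sup_ubound; exists x.
rewrite lee_fin -(ler_pM2r nv0); apply: le_trans.
by rewrite linearZ enormZ ger0_norm ?invr_ge0 ?enorm_ge0// mulrC mulVKf ?gt_eqF.
Qed.

(** Testing the mean value theorem against w = f u - f v itself gives
    |w|^2 = <w, df (u - v)> <= |w| e |u - v|. *)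
Lemma lipschitz_diff_supnorm f u v e : (forall z, differentiable f z) ->
  (diff_supnorm f < e%:E)%E -> enorm (f u - f v) <= e * enorm (u - v).
Proof.
move=> df fe; set w := f u - f v.
have [-> |w0] := eqVneq w 0.
  rewrite enorm0; apply: le_trans (le_enorm_opnorm v (u - v) fe).
  exact: enorm_ge0.
have nw0 : 0 < enorm w.
  by rewrite lt0r enorm_ge0 andbT; apply: contra_neq w0 => /enorm0_eq0.
have [c _ wE] := mean_value_dotv u v w df.
rewrite -(ler_pM2l nw0) -expr2 sqr_enorm wE (le_trans (dotv_le_enorm _ _))//.
by rewrite ler_pM2l// le_enorm_opnorm.
Qed.

End MeanValue.

(** * Discrete sets, local patches and differences *)

Section Discrete.
Variables (R : realType) (n : nat).
Implicit Types (P : set 'rV[R]_n) (p q u v w x y : 'rV[R]_n).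

Lemma finite_fibers_le1 (T : Type) (U : finType) (f : T -> U) (A : set T) :
  (forall a b, A a -> A b -> f a = f b -> a = b) -> finite_set A.
Proof.
move=> inj_f.
apply: (@sub_finite_set _ _ (\bigcup_(u in [set: U]) (A `&` f @^-1` [set u]))).
  by move=> x Ax; exists (f x).
apply: bigcup_finite => // u _.
have [->|/set0P[x [Ax fx]]] := eqVneq (A `&` f @^-1` [set u]) set0.
  exact: finite_set0.
apply: (@sub_finite_set _ _ [set x]); last exact: finite_set1.
by move=> y [Ay fy]; apply: inj_f => //; rewrite fx fy.
Qed.

(** Pigeonhole on a cubic grid: a bounded set meets finitely many cells, and
    two points in one cell are too close to be distinct. *)
Lemma finite_bounded_separated (A : set 'rV[R]_n) (r d : R) : 0 < d ->
  (forall x, A x -> enorm x < r) ->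
  (forall x y, A x -> A y -> enorm (x - y) < d -> x = y) -> finite_set A.
Proof.
move=> d0 Ar Ad.
(* With this mesh the cells have diameter at most n h < d; the successor keeps
   h well defined in dimension 0. *)
pose h := d / n.+1%:R.
have h0 : 0 < h by rewrite divr_gt0.
pose N := Num.truncn (2 * r / h).
pose cell x i := Num.truncn ((x 0 i + r) / h).
have cellP x i : A x ->
    (cell x i)%:R * h <= x 0 i + r < (cell x i).+1%:R * h /\
    (cell x i < N.+1)%N.
  move=> /Ar xr; have := le_lt_trans (coord_le_enorm x i) xr.
  rewrite ltr_norml => /andP[rx xr'].
  have x0 : 0 <= (x 0 i + r) / h by rewrite divr_ge0 ?(ltW h0)//; lra.
  split; first by rewrite -ler_pdivlMr// -ltr_pdivrMr// truncn_itv.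
  by rewrite ltnS le_truncn// ler_wpM2r ?invr_ge0 ?(ltW h0)//; lra.
apply: (@finite_fibers_le1 _ _
  (fun x => [ffun i => inord (cell x i) : 'I_N.+1])).
move=> x y Ax Ay /ffunP exy; apply: Ad => //.
have hn : n%:R * h < d.
  by rewrite mulrCA gtr_pMr// ltr_pdivrMr// mul1r ltr_nat.
apply: le_lt_trans hn; apply: enorm_le_coord (ltW h0) _ => i.
have [/andP[x1 x2] xN] := cellP x i Ax.
have [/andP[y1 y2] yN] := cellP y i Ay.
have := exy i; rewrite !ffunE => /(congr1 (@nat_of_ord _)).
rewrite !inordK// => exyi; rewrite -{}exyi in y1 y2.
rewrite !mxE ler_norml; move: x2 y2; rewrite -natr1 mulrDl mul1r => x2 y2.
by apply/andP; split; lra.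
Qed.

(** The defining infimum may be +oo, and then any positive number separates. *)
Lemma uniformly_discrete_separated P : uniformly_discrete P ->
  exists2 d : R, 0 < d & forall x y, P x -> P y -> enorm (x - y) < d -> x = y.
Proof.
rewrite /uniformly_discrete; set I := ereal_inf _ => I0.
have [d d0 dI] : exists2 d : R, 0 < d & (d%:E <= I)%E.
  by case: I I0 => [a||] //=; [exists a | exists 1; rewrite ?leey].
exists d => // x y Px Py; apply: contraPP => /eqP xy.
apply/negP; rewrite -leNgt -lee_fin (le_trans dI)//.
by apply: ereal_inf_lbound; exists x, y.
Qed.

Lemma mem_local_patch (r : R) P x v :
  local_patch r (translate P x) v <-> enorm v < r /\ P (x + v).
Proof.
split=> [[/=]|[vr Pv]].
  rewrite /eball /= subr0 => vr [p Pp pv]; split=> //.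
  by rewrite -pv addrC subrK.
split; first by rewrite /eball /= subr0.
by exists (x + v) => //; rewrite addrAC subrr add0r.
Qed.

(** A difference of length less than r is an element of one of the finitely many
    patches of radius r centred at points of P, and each patch is finite. *)
Lemma finite_differences P (r : R) :
  uniformly_discrete P -> finite_local_complexity P ->
  finite_set [set v | enorm v < r /\ exists2 p, P p & P (p + v)].
Proof.
move=> /uniformly_discrete_separated[d d0 Pd] /(_ r) PF.
apply: (@sub_finite_set _ _
  (\bigcup_(A in [set local_patch r (translate P x) | x in P]) A)).
  move=> v [vr [p Pp Pv]].
  by exists (local_patch r (translate P p)); [exists p | apply/mem_local_patch].
apply: bigcup_finite => // _ [p Pp <-].
apply: (@finite_bounded_separated _ r d) => // [v /mem_local_patch[]//|].
move=> u v /mem_local_patch[_ Pu] /mem_local_patch[_ Pv] uv.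
apply: (@addrI _ p); apply: Pd => //.
by rewrite [p + v]addrC opprD addrA addrAC [p + u]addrC addrK.
Qed.

Lemma finite_set_separated (A : set 'rV[R]_n) : finite_set A ->
  exists2 d : R, 0 < d & forall x y, A x -> A y -> enorm (x - y) < d -> x = y.
Proof.
move=> /finite_seqP[s ->].
pose dist (z : 'rV[R]_n * 'rV[R]_n) := enorm (z.1 - z.2).
pose pairs := [seq (x, y) | x <- s, y <- s].
exists (\big[Num.min/1]_(z <- pairs | z.1 != z.2) dist z).
  apply: (big_ind (fun m : R => 0 < m)) => // [a b a0 b0|z z12].
    by rewrite lt_min a0.
  rewrite lt0r enorm_ge0 andbT.
  by apply: contra_neq z12 => /enorm0_eq0/subr0_eq.
move=> x y /= xs ys; apply: contraPP => /eqP xy; apply/negP; rewrite -leNgt.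
exact: (ge_bigmin_seq _ (x, y) _ dist (allpairs_f pair xs ys) xy).
Qed.

(** This separation is the source of rigidity: a short difference of points of
    P is determined by any sufficiently good approximation of it. *)
Lemma differences_separated P (r : R) :
  uniformly_discrete P -> finite_local_complexity P ->
  exists2 d : R, 0 < d & forall p q p' q', P p -> P q -> P p' -> P q' ->
    enorm (p - q) < r -> enorm (p' - q') < r ->
    enorm ((p - q) - (p' - q')) < d -> p - q = p' - q'.
Proof.
move=> PU PF.
have [d d0 dP] := finite_set_separated (finite_differences r PU PF).
exists d => // p q p' q' Pp Pq Pp' Pq' pq pq'; apply: dP.
  by split=> //; exists q; rewrite // addrC subrK.
by split=> //; exists q'; rewrite // addrC subrK.
Qed.

(** Induction along chains of short steps in P, starting from p0. A point p of
    P at distance at least 3 r from p0 has a neighbour q in P that is closer to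
    p0 by more than r: go back from p towards p0 by 2 r and take a point of P
    within r of the place reached. All points of the chain thus stay in the
    ball of radius S around p0. *)
Lemma relatively_dense_ind P (r : R) p0 (Q : 'rV[R]_n -> Prop) (S : R) :
  (forall x, local_patch r (translate P x) !=set0) ->
  P p0 -> Q p0 ->
  (forall p q, P p -> P q -> enorm (p - p0) < S -> enorm (p - q) < 3 * r ->
     Q q -> Q p) ->
  forall p, P p -> enorm (p - p0) < S -> Q p.
Proof.
move=> Pr Pp0 Qp0 step.
have r0 : 0 < r.
  have [v /mem_local_patch[vr _]] := Pr 0.
  exact: le_lt_trans (enorm_ge0 v) vr.
suff main N p : P p -> enorm (p - p0) < S -> enorm (p - p0) <= N%:R * r -> Q p.
  move=> p Pp pS; apply: (main (Num.truncn (enorm (p - p0) / r)).+1) => //.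
  by rewrite -ler_pdivrMr// ltW// truncnS_gt.
elim: N p => [|N IHN] p Pp pS pN.
  suff -> : p = p0 by [].
  apply/subr0_eq/enorm0_eq0/le_anti.
  by rewrite enorm_ge0 andbT (le_trans pN)// mul0r.
set l := enorm (p - p0) in pS pN *.
have [l2|l2] := ltrP l (3 * r); first exact: (step p p0).
have l0 : 0 < l by lra.
pose z := p - (2 * r / l) *: (p - p0).
have pz : enorm (p - z) = 2 * r.
  rewrite /z opprB addrC subrK enormZ -/l ger0_norm; last first.
    by rewrite divr_ge0 ?mulr_ge0 ?ltW.
  by rewrite divfK ?gt_eqF.
have zp0 : enorm (z - p0) = l - 2 * r.
  have -> : z - p0 = (1 - 2 * r / l) *: (p - p0).
    by rewrite scalerBl scale1r /z addrAC.
  rewrite enormZ -/l ger0_norm; last by rewrite subr_ge0 ler_pdivrMr//; lra.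
  by rewrite mulrBl mul1r divfK ?gt_eqF.
have [v /mem_local_patch[vr Pq]] := Pr z.
have qp0 : enorm (z + v - p0) < l - r.
  rewrite addrAC (le_lt_trans (ler_enormD _ _))// zp0; lra.
apply: (step p (z + v)) => //.
  by rewrite opprD addrA (le_lt_trans (ler_enormD _ _))// enormN pz; lra.
apply: IHN => //; first by rewrite (lt_trans qp0)//; lra.
by rewrite (le_trans (ltW qp0))// ; move: pN; rewrite -natr1 mulrDl mul1r; lra.
Qed.

(** Two one-sided transfers between the points of P near p0 and those near
    p0 + t amount to equality of patches, for every centre z whose patch fits in
    the ball of radius S around p0. *)
Lemma local_patch_shift P p0 t (S : R) :
  (forall p, P p -> enorm (p - p0) < S -> P (p + t)) ->
  (forall q, P q -> enorm (q - (p0 + t)) < S -> P (q - t)) ->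
  forall z (r : R), enorm (z - p0) + r <= S ->
    local_patch r (translate P z) = local_patch r (translate P (z + t)).
Proof.
move=> PS SP z r zrS; apply/seteqP; split => v /mem_local_patch[vr Pv];
  apply/mem_local_patch; split=> //.
  rewrite addrAC; apply: PS => //.
  by rewrite addrAC (le_lt_trans (ler_enormD _ _))//; lra.
rewrite -(addrK t (z + v)); rewrite addrAC in Pv; apply: SP => //.
rewrite opprD addrACA subrr addr0 addrAC.
by rewrite (le_lt_trans (ler_enormD _ _))//; lra.
Qed.

End Discrete.

(** * Maps with translation-invariant derivative along a segment *)

Section Translation.
Variables (R : realType) (n : nat).
Implicit Types (phi : 'rV[R]_n -> 'rV[R]_n) (u v t z : 'rV[R]_n).

Lemma is_diff_translate phi t z : differentiable phi (z + t) ->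
  is_diff z (fun z => phi (z + t)) ('d phi (z + t)).
Proof.
move=> dphi.
have dt : is_diff z (fun z => z + t) id.
  have := is_diffD (is_diff_id z) (is_diff_cst t z).
  by rewrite addr0.
have dp : is_diff (z + t) phi ('d phi (z + t)) by apply: DiffDef.
exact: (is_diff_comp dt dp).
Qed.

(** The function h z = phi (z + t) - phi z has derivative zero along the segment
    from v to u, so it takes the same value at both ends. *)
Lemma eq_diff_translate phi u v t : (forall z, differentiable phi z) ->
  (forall c : R, 0 <= c <= 1 -> 'd phi (v + c *: (u - v) + t) =
     'd phi (v + c *: (u - v)) :> ('rV[R]_n -> 'rV[R]_n)) ->
  phi (u + t) - phi (v + t) = phi u - phi v.
Proof.
move=> dphi eqd.
pose h z : 'rV[R]_n := phi (z + t) - phi z.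
have dh z : is_diff z h ('d phi (z + t) \- 'd phi z).
  have dt := is_diff_translate (dphi (z + t)).
  have dp : is_diff z phi ('d phi z) by apply: DiffDef.
  exact: (is_diffB dt dp).
have [|c c01 hE] := mean_value_dotv u v (h u - h v) (f := h).
  by move=> z; have [] := dh z.
have dh0 k : 'd h (v + c *: (u - v)) k = 0.
  have E1 := congr1 (fun g : 'rV[R]_n -> 'rV[R]_n => g k)
    (diff_val (is_diff_def := dh (v + c *: (u - v)))).
  have E2 := congr1 (fun g : 'rV[R]_n -> 'rV[R]_n => g k) (eqd c c01).
  apply: (etrans E1).
  by apply/eqP; rewrite subr_eq0; apply/eqP.
have : h u - h v = 0.
  by apply/enorm0_eq0/eqP; rewrite -sqrf_eq0 sqr_enorm hE dh0 dotv0.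
move=> /subr0_eq huv.
have -> : phi (u + t) = (phi (v + t) - phi v) + phi u.
  by apply/eqP; rewrite -subr_eq; apply/eqP.
by rewrite addrC addrA addKr addrC.
Qed.

End Translation.

(** * Rigidity of small deformations *)

Section Rigidity.
Variables (R : realType) (n : nat) (P : set 'rV[R]_n).
Variables (rho d e : R) (phi : 'rV[R]_n -> 'rV[R]_n).
Implicit Types (p q u v x y z : 'rV[R]_n).

Hypothesis rho_cover : forall x, local_patch rho (translate P x) !=set0.
Hypothesis d_sep : forall p q p' q', P p -> P q -> P p' -> P q' ->
  enorm (p - q) < 9 * rho -> enorm (p' - q') < 9 * rho ->
  enorm ((p - q) - (p' - q')) < d -> p - q = p' - q'.
Hypotheses (e0 : 0 < e) (e_half : e <= 1 / 2) (e_d : 12 * rho * e <= d).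
Hypothesis phi_lip : forall u v,
  enorm ((phi u - phi v) - (u - v)) <= e * enorm (u - v).

(** The bounds e <= 1/2 and |(phi - id) u - (phi - id) v| <= e |u - v| make phi
    bi-Lipschitz; these two lemmas fix the constants. *)
Lemma deform_le u v : enorm (phi u - phi v) <= 3 / 2 * enorm (u - v).
Proof.
have := ler_enormD ((phi u - phi v) - (u - v)) (u - v); rewrite subrK.
have := phi_lip u v; have : e * enorm (u - v) <= 1 / 2 * enorm (u - v).
  by rewrite ler_wpM2r ?enorm_ge0.
lra.
Qed.

Lemma deform_ge u v : enorm (u - v) <= 2 * enorm (phi u - phi v).
Proof.
have := ler_enorm_dist (phi u - phi v) (u - v) 0; rewrite !subr0.
rewrite [enorm (u - v - _)]enorm_distC.
have := phi_lip u v; have : e * enorm (u - v) <= 1 / 2 * enorm (u - v).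
  by rewrite ler_wpM2r ?enorm_ge0.
lra.
Qed.

Lemma deform_inj u v : phi u = phi v -> u = v.
Proof.
move=> uv; apply/subr0_eq/enorm0_eq0/le_anti; rewrite enorm_ge0 andbT.
by rewrite (le_trans (deform_ge u v))// uv subrr enorm0 mulr0.
Qed.

(** The bi-Lipschitz bounds turn |p - q| < 3 rho into |p' - q'| < 9 rho, so the
    two differences, which phi deforms to the same vector, are at distance less
    than e (3 rho + 9 rho) <= d and the separation applies. *)
Lemma eq_neighbor_difference p q p' q' : P p -> P q -> P p' -> P q' ->
  enorm (p - q) < 3 * rho -> phi p' - phi q' = phi p - phi q ->
  p' - q' = p - q.
Proof.
move=> Pp Pq Pp' Pq' pq pq'E.
have rho0 : 0 < rho by have := enorm_ge0 (p - q); lra.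
have pq' : enorm (p' - q') < 9 * rho.
  rewrite (le_lt_trans (deform_ge _ _))// pq'E.
  by have := deform_le p q; lra.
apply: d_sep => //; first lra.
rewrite (le_lt_trans (ler_enorm_dist (phi p - phi q) _ _))//.
rewrite -{1}pq'E enorm_distC.
have lt12 : e * enorm (p' - q') + e * enorm (p - q) < 12 * rho * e.
  by rewrite -mulrDr mulrC ltr_pM2r//; lra.
rewrite (lt_le_trans _ e_d)// (le_lt_trans _ lt12)//.
by rewrite lerD.
Qed.

(** The point p' whose image sits relative to phi y as phi p does relative to
    phi x is p + (p0' - p0). This holds for p0, and it passes from q to a
    neighbour p by rigidity of the difference p - q. The radius r' is such that
    the images of all the points p involved are visible from phi x. *)
Lemma transfer_points x y p0 p0' (K S r' : R) :
  P p0 -> P p0' -> phi p0 - phi x = phi p0' - phi y ->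
  enorm (p0 - x) < K -> 3 / 2 * (S + K) <= r' ->
  local_patch r' (translate (phi @` P) (phi x)) =
    local_patch r' (translate (phi @` P) (phi y)) ->
  forall p, P p -> enorm (p - p0) < S -> P (p + (p0' - p0)).
Proof.
move=> Pp0 Pp0' p0E p0K SKr xyE p Pp pS.
set t := p0' - p0.
pose Q p := P (p + t) /\ phi (p + t) - phi y = phi p - phi x.
suff: Q p by case.
apply: (relatively_dense_ind (Q := Q) rho_cover Pp0 _ _ Pp pS).
  by rewrite /Q /t addrC subrK p0E.
move=> {Pp pS}p q Pp Pq pS pq [Pqt qE].
have pr' : enorm (phi p - phi x) < r'.
  have := deform_le p x; have := ler_enorm_dist p0 p x; lra.
have : local_patch r' (translate (phi @` P) (phi x)) (phi p - phi x).
  by apply/mem_local_patch; split=> //; exists p; rewrite // addrC subrK.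
rewrite xyE => /mem_local_patch[_ [p' Pp' p'E]].
have {}p'E : phi p' - phi y = phi p - phi x by rewrite p'E addrC addKr.
have p'q : p' - (q + t) = p - q.
  apply: eq_neighbor_difference => //.
  have subBB (a b c : 'rV[R]_n) : a - b = (a - c) - (b - c).
    by rewrite opprB addrA subrK.
  by rewrite (subBB _ _ (phi y)) [RHS](subBB _ _ (phi x)) p'E qE.
suff pt : p + t = p' by rewrite /Q pt.
by rewrite -(subrK (q + t) p') p'q [RHS]addrA subrK.
Qed.

End Rigidity.

(** * Recovering the patches of P from those of phi(P) *)

Unset Implicit Arguments.

Theorem theorem4p18 (R : realType) (n : nat) (P : set 'rV[R]_n)
    (HD : delone P) (HF : finite_local_complexity P) :
  exists eps : R, [/\ 0 < eps, eps < 1 &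
    forall phi : 'rV[R]_n -> 'rV[R]_n,
      (forall x, differentiable phi x) ->
      strongly_equivariant P (fun x => 'd phi x : 'rV[R]_n -> 'rV[R]_n) ->
      (diff_supnorm (phi - id)%R < eps%:E)%E ->
      forall r : R, 0 < r -> exists r' : R, 0 < r' /\
        forall x y : 'rV[R]_n,
          local_patch r' (translate (phi @` P) (phi x)) =
            local_patch r' (translate (phi @` P) (phi y)) ->
          local_patch r (translate P x) = local_patch r (translate P y)].
Proof.
have [HU [rho cover]] := HD.
have rho0 : 0 < rho.
  have [v /mem_local_patch[vr _]] := cover 0.
  exact: le_lt_trans (enorm_ge0 v) vr.
have [d d0 dP] := differences_separated (9 * rho) HU HF.
pose e := Num.min (1 / 2) (d / (12 * rho)).
have e0 : 0 < e by rewrite lt_min !divr_gt0// mulr_gt0.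
have e_half : e <= 1 / 2 by rewrite ge_min lexx.
have e_d : 12 * rho * e <= d.
  by rewrite mulrC -ler_pdivlMr ?mulr_gt0// ge_min lexx orbT.
exists e; split=> //; first lra.
move=> phi dphi [rad eqv] phi_e r r0.
have dpsi z : differentiable (phi - id) z by exact: differentiableB.
have phi_lip u v : enorm ((phi u - phi v) - (u - v)) <= e * enorm (u - v).
  have -> : (phi u - phi v) - (u - v) = (phi - id) u - (phi - id) v.
    change (phi u - phi v - (u - v) = (phi u - u) - (phi v - v)).
    by rewrite !opprD !opprK addrACA.
  exact: (lipschitz_diff_supnorm u v dpsi phi_e).
(* p0 will be within rho of x and p0' within 4 rho of y; the patches of P to
   be compared have radius r or rad and centres within rho of p0. *)
pose S := 4 * rho + r + `|rad|.
have rad0 : 0 <= `|rad| by [].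
have radS : rad <= `|rad| by rewrite ler_norm.
exists (3 / 2 * (S + 4 * rho)); split; first by rewrite /S; lra.
move=> x y xyE.
have [v /mem_local_patch[vr Pp0]] := cover x.
set p0 := x + v in Pp0.
have p0x : enorm (p0 - x) < rho by rewrite /p0 addrC addKr.
have [p0' Pp0' p0E] : exists2 p0', P p0' & phi p0 - phi x = phi p0' - phi y.
  have : local_patch (3 / 2 * (S + 4 * rho)) (translate (phi @` P) (phi x))
      (phi p0 - phi x).
    apply/mem_local_patch; split; last by exists p0; rewrite // addrC subrK.
    have := deform_le e_half phi_lip p0 x; rewrite /S; lra.
  rewrite xyE => /mem_local_patch[_ [p' Pp' p'E]].
  by exists p' => //; rewrite p'E [RHS]addrC addKr.
set t := p0' - p0.
have tE : p0 + t = p0' by rewrite /t addrC subrK.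
have p0'y : enorm (p0' - y) < 4 * rho.
  have := deform_ge e_half phi_lip p0' y.
  have := deform_le e_half phi_lip p0 x; rewrite p0E; lra.
have PS p : P p -> enorm (p - p0) < S -> P (p + t).
  apply: (transfer_points cover dP e0 e_half e_d phi_lip
    Pp0 Pp0' p0E _ (lexx _) xyE); lra.
have SP q : P q -> enorm (q - (p0 + t)) < S -> P (q - t).
  rewrite tE (opprB p0' p0 : - t = _).
  exact: (transfer_points cover dP e0 e_half e_d phi_lip
    Pp0' Pp0 (esym p0E) p0'y (lexx _) (esym xyE)).
have shift := local_patch_shift PS SP.
suff -> : y = x + t.
  by apply: shift; rewrite enorm_distC /S; move: p0x rad0 rho0; lra.
apply: (deform_inj e_half phi_lip).
have eqd (c : R) : 0 <= c <= 1 -> 'd phi (p0 + c *: (x - p0) + t) =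
    'd phi (p0 + c *: (x - p0)) :> ('rV[R]_n -> 'rV[R]_n).
  move=> /andP[c0 c1]; apply/esym/eqv/shift.
  have -> : p0 + c *: (x - p0) - p0 = c *: (x - p0) by rewrite addrC addKr.
  rewrite enormZ ger0_norm// enorm_distC.
  have : c * enorm (p0 - x) <= 1 * enorm (p0 - x).
    by rewrite ler_wpM2r ?enorm_ge0.
  rewrite /S; lra.
have := eq_diff_translate dphi eqd.
rewrite tE => xtE; apply/esym/(addIr (- phi p0')).
by rewrite xtE -opprB p0E opprB.
Qed.
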